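(* Let $\mathcal{H}$ be a complex Hilbert space and let $T\in\mathcal{B}(\mathcal{H}\oplus\mathcal{H})$ be accretive-dissipative, with Cartesian decomposition $$T=\begin{bmatrix} A_{11} & A_{12}\\ A_{12}^* & A_{22}\end{bmatrix}+\mathrm{i}\begin{bmatrix} B_{11} & B_{12}\\ B_{12}^* & B_{22}\end{bmatrix},$$ where all blocks belong to $\mathcal{B}(\mathcal{H})$. Then $$\|T\|\le\sqrt{\left(\|A_{11}\|+\|A_{22}\|\right)^2+\left(\|B_{11}\|+\|B_{22}\|\right)^2}.$$
   Context: $\mathcal{B}(\mathcal{K})$ denotes the algebra of bounded linear operators on a complex Hilbert space $\mathcal{K}$, and $\|\cdot\|$ is the operator norm. The real and imaginary parts of $S\in\mathcal{B}(\mathcal{K})$ are $\mathcal{R}S=\frac{S+S^*}{2}$ and $\mathcal{I}S=\frac{S-S^*}{2\mathrm{i}}$, both self-adjoint, and the Cartesian decomposition of $S$ is $S=\mathcal{R}S+\mathrm{i}\,\mathcal{I}S$; thus in the claim $\begin{bmatrix} A_{11} & A_{12}\\ A_{12}^* & A_{22}\end{bmatrix}=\mathcal{R}T$ and $\begin{bmatrix} B_{11} & B_{12}\\ B_{12}^* & B_{22}\end{bmatrix}=\mathcal{I}T$. An operator $S$ is positive ($S\ge O$) if $\langle Sx,x\rangle\ge0$ for all $x$; $S$ is accretive-dissipative if $\mathcal{R}S\ge O$ and $\mathcal{I}S\ge O$. *)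

(* Defs.v *)
From HB Require Import structures.
From mathcomp Require Import all_boot all_order all_algebra.
From mathcomp Require Import complex.
From mathcomp Require Import boolp classical_sets functions reals topology normedtype.
From mathcomp Require Import ring lra.
Set Implicit Arguments.
Unset Strict Implicit.
Unset Printing Implicit Defensive.
Import Order.TTheory GRing.Theory Num.Theory.
Import numFieldNormedType.Exports.
Local Open Scope classical_set_scope.
Local Open Scope ring_scope.

Section DotNorm.
Variables (C : numClosedFieldType) (U : lmodType C) (dot : {dot U for Num.conj}).
Implicit Types (u v : U) (a : C).

Definition dnorm u : C := sqrtC (dot u u).

Lemma dnorm_sqr u : dnorm u ^+ 2 = dot u u.
Proof. by rewrite sqrtCK. Qed.

Lemma dnorm_nneg u : 0 <= dnorm u.
Proof. by rewrite sqrtC_ge0 dnorm_ge0. Qed.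

Lemma dot_CauchySchwarz u v : `|dot u v| <= dnorm u * dnorm v.
Proof.
rewrite -(@ler_pXn2r _ 2) ?nnegrE ?mulr_ge0 ?normr_ge0 ?dnorm_nneg//.
rewrite exprMn !dnorm_sqr.
have [->|v0] := eqVneq v 0; first by rewrite !linear0r normr0 expr0n/= mulr0.
wlog ou : u / dot u v = 0.
  move=> IH; pose a := dot u v / dot v v; pose w := u - a *: v.
  have ow : dot w v = 0.
    by rewrite linearBl linearZl_LR divfK ?dnorm_eq0 ?subrr.
  have -> : u = w + a *: v by rewrite subrK.
  rewrite linearDl /= ow add0r linearZl_LR normrM (ger0_norm (dnorm_ge0 _ _)).
  have -> : dot (w + a *: v) (w + a *: v) = dot w w + `|a| ^+ 2 * dot v v.
    by rewrite -dnormZ; apply: hnormDd; rewrite linearZr_LR/= ow mulr0.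
  by rewrite exprMn [X in _ * X]expr2 mulrA mulrDl lerDr mulr_ge0.
by rewrite ou normr0 expr0n/= mulr_ge0.
Qed.

Lemma dnorm_triangle u v : dnorm (u + v) <= dnorm u + dnorm v.
Proof.
rewrite -(@ler_pXn2r _ 2) ?nnegrE ?addr_ge0 ?dnorm_nneg//.
rewrite sqrrD !dnorm_sqr dnormD [leRHS]addrAC lerD2l -mulr_natl.
have -> : dot u v + (dot u v)^* = 2 * 'Re (dot u v).
  by rewrite ReE mulrC divfK ?pnatr_eq0.
rewrite ler_pM2l ?ltr0n//.
apply: le_trans (dot_CauchySchwarz u v).
exact: leif_Re_Creal.
Qed.

End DotNorm.

(* A Hilbert space over R[i]: a complete normed module whose norm is the one
   of a positive definite hermitian form, linear in its first argument. *)
HB.mixin Record CompleteNormedModule_isHilbert (R : realType) H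
    & CompleteNormedModule R[i] H := {
  hdot : {dot H for (@Num.conj R[i])} ;
  hdot_norm : forall x : H, hdot x x = `|x| ^+ 2
}.

#[short(type="hilbertType")]
HB.structure Definition Hilbert (R : realType) :=
  {H of CompleteNormedModule R[i] H & CompleteNormedModule_isHilbert R H}.

Lemma dnorm_hdot (R : realType) (H : hilbertType R) (x : H) :
  dnorm hdot x = `|x|.
Proof. by rewrite /dnorm hdot_norm sqrCK. Qed.

Lemma hdot_CauchySchwarz (R : realType) (H : hilbertType R) (x y : H) :
  `|hdot x y| <= `|x| * `|y|.
Proof. by rewrite -!dnorm_hdot dot_CauchySchwarz. Qed.

(* The type H1 * H2 carries the max norm in the library, hence the alias. *)
Definition hsum (R : realType) (H1 H2 : hilbertType R) : Type := (H1 * H2)%type.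

Section Hsum.
Variables (R : realType) (H1 H2 : hilbertType R).

HB.instance Definition _ := GRing.Lmodule.copy (hsum H1 H2) (H1 * H2)%type.

Definition hsum_dot (x y : hsum H1 H2) : R[i] := hdot x.1 y.1 + hdot x.2 y.2.

Lemma hsum_dot_is_bilinear :
  bilinear_for (GRing.Scale.Law.clone _ _ *%R _)
    (GRing.Scale.Law.clone _ _ (Num.conj \; *%R) _) hsum_dot.
Proof.
split=> [y|x] a u v /=; rewrite /hsum_dot /=.
  by rewrite !linearPl mulrDr addrACA.
by rewrite !linearPr/= mulrDr addrACA.
Qed.

HB.instance Definition _ := bilinear_isBilinear.Build R[i] (hsum H1 H2)
  (hsum H1 H2) R[i] _ _ hsum_dot hsum_dot_is_bilinear.

Lemma hsum_dot_hermitian (x y : hsum H1 H2) :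
  hsum_dot x y = (-1) ^+ false * Num.conj (hsum_dot y x).
Proof. by rewrite mul1r rmorphD/= /hsum_dot !(hermC hdot x.1) (hermC hdot x.2) !mul1r. Qed.

HB.instance Definition _ := isHermitianSesquilinear.Build R[i] (hsum H1 H2)
  false Num.conj hsum_dot hsum_dot_hermitian.

Lemma hsum_dot_gt0 (x : hsum H1 H2) : x != 0 -> 0 < hsum_dot x x.
Proof.
case: x => x1 x2 x0; rewrite /hsum_dot/= lt_neqAle eq_sym addr_ge0 ?dnorm_ge0//.
rewrite andbT paddr_eq0 ?dnorm_ge0// !dnorm_eq0.
by apply: contra x0 => /andP[/eqP -> /eqP ->].
Qed.

HB.instance Definition _ := isDotProduct.Build R[i] (hsum H1 H2) hsum_dot
  hsum_dot_gt0.

Definition hsum_norm (x : hsum H1 H2) : R[i] := sqrtC (hsum_dot x x).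

Lemma hsum_norm_triangle x y : hsum_norm (x + y) <= hsum_norm x + hsum_norm y.
Proof. exact: (dnorm_triangle hsum_dot). Qed.

Lemma hsum_normZ (a : R[i]) x : hsum_norm (a *: x) = `|a| * hsum_norm x.
Proof.
rewrite /hsum_norm (dnormZ hsum_dot) rootCMl ?exprn_ge0//.
by rewrite sqrCK.
Qed.

Lemma hsum_norm_eq0 x : hsum_norm x = 0 -> x = 0.
Proof. by move/eqP; rewrite sqrtC_eq0 (dnorm_eq0 hsum_dot) => /eqP. Qed.

HB.instance Definition _ := Lmodule_isNormed.Build R[i] (hsum H1 H2)
  hsum_norm_triangle hsum_normZ hsum_norm_eq0.

Lemma hsum_norm_sqr (x : hsum H1 H2) : `|x| ^+ 2 = `|x.1| ^+ 2 + `|x.2| ^+ 2.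
Proof. by rewrite [LHS]sqrtCK /hsum_dot !hdot_norm. Qed.

Lemma hsum_norm1 (x : hsum H1 H2) : `|x.1| <= `|x|.
Proof.
by rewrite -(@ler_pXn2r _ 2) ?nnegrE// hsum_norm_sqr lerDl exprn_ge0.
Qed.

Lemma hsum_norm2 (x : hsum H1 H2) : `|x.2| <= `|x|.
Proof.
by rewrite -(@ler_pXn2r _ 2) ?nnegrE// hsum_norm_sqr lerDr exprn_ge0.
Qed.

Lemma hsum_normD (x : hsum H1 H2) : `|x| <= `|x.1| + `|x.2|.
Proof.
rewrite -(@ler_pXn2r _ 2) ?nnegrE ?addr_ge0// hsum_norm_sqr sqrrD.
by rewrite addrAC lerDl mulrn_wge0 ?mulr_ge0.
Qed.

Lemma hsum_complete (F : set_system (hsum H1 H2)) :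
  ProperFilter F -> cauchy F -> cvg F.
Proof.
move=> FF /cauchyP Fc.
have c1 : cvg ((fun x : hsum H1 H2 => x.1) @ F).
  apply: cauchy_cvg; apply: cauchy_exP => e /Fc[x Fx]; exists x.1.
  suff : F [set y | ball x.1 e y.1] by [].
  apply: filterS Fx => y; rewrite -!ball_normE/=; apply: le_lt_trans.
  exact: (hsum_norm1 (x - y)).
have c2 : cvg ((fun x : hsum H1 H2 => x.2) @ F).
  apply: cauchy_cvg; apply: cauchy_exP => e /Fc[x Fx]; exists x.2.
  suff : F [set y | ball x.2 e y.2] by [].
  apply: filterS Fx => y; rewrite -!ball_normE/=; apply: le_lt_trans.
  exact: (hsum_norm2 (x - y)).
move/cvg_ex : c1 => [l1 l1F]; move/cvg_ex : c2 => [l2 l2F].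
apply/cvg_ex; exists ((l1, l2) : hsum H1 H2).
apply/cvgrPdist_lt => e e0.
have e20 : 0 < e / 2 by rewrite divr_gt0.
move/cvgrPdist_lt : l1F => /(_ _ e20) l1F.
move/cvgrPdist_lt : l2F => /(_ _ e20) l2F.
apply: filterS2 l1F l2F => x x1 x2; rewrite (splitr e).
apply: le_lt_trans (ltrD x1 x2).
exact: (hsum_normD (((l1, l2) : hsum H1 H2) - x)).
Qed.

HB.instance Definition _ := Uniform_isComplete.Build (hsum H1 H2) hsum_complete.

Lemma hsum_dot_norm (x : hsum H1 H2) : hsum_dot x x = `|x| ^+ 2.
Proof. by rewrite sqrtCK. Qed.

HB.instance Definition _ := CompleteNormedModule_isHilbert.Build R (hsum H1 H2)
  hsum_dot_norm.

End Hsum.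

(* A continuous linear functional is represented by the minimizer of
   `|x| ^+ 2 - 2 * Re (phi x). *)
Section Riesz.
Variables (R : realType) (H : hilbertType R) (phi : H -> R[i]) (M : R).
Hypothesis phi_lin : scalar phi.
Hypothesis phi_bnd : forall x, `|phi x| <= M%:C%C * `|x|.

Let nr (x : H) : R := complex.Re `|x|.
Let J (x : H) : R := nr x ^+ 2 - 2 * complex.Re (phi x).

Let nrE x : `|x| = (nr x)%:C%C.
Proof. by rewrite /nr RRe_real// normr_real. Qed.

Let nr_ge0 x : 0 <= nr x.
Proof. by rewrite -ler0c -nrE. Qed.

Let nr_dot x : nr x ^+ 2 = complex.Re (hdot x x).
Proof. by rewrite hdot_norm nrE -rmorphXn. Qed.

Let phiD x y : phi (x + y) = phi x + phi y.
Proof. by rewrite -[x in LHS]scale1r phi_lin mul1r. Qed.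

Let phi0 : phi 0 = 0.
Proof. by apply: (addrI (phi 0)); rewrite -phiD !addr0. Qed.

Let phiZ a x : phi (a *: x) = a * phi x.
Proof. by rewrite -[a *: x]addr0 phi_lin phi0 addr0. Qed.

Let Re_le (z : R[i]) : `|complex.Re z| <= complex.Re `|z|.
Proof.
case: z => a b /=; rewrite -sqrtr_sqr ler_wsqrtr// lerDl.
exact: sqr_ge0.
Qed.

Let ReD (z w : R[i]) : complex.Re (z + w) = complex.Re z + complex.Re w.
Proof. by case: z w => [? ?] [? ?]. Qed.

Let ReN (z : R[i]) : complex.Re (- z) = - complex.Re z.
Proof. by case: z. Qed.

Let ReZ (a : R) (z : R[i]) : complex.Re (a%:C%C * z) = a * complex.Re z.
Proof. by case: z => ? ? /=; rewrite mul0r subr0. Qed.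

Let ReC (z : R[i]) : complex.Re (Num.conj z) = complex.Re z.
Proof. by case: z. Qed.

Let conj_real (t : R) : Num.conj t%:C%C = t%:C%C.
Proof. exact: conjc_real. Qed.

Let Re_dotC (x y : H) : complex.Re (hdot x y) = complex.Re (hdot y x).
Proof. by rewrite hermC mul1r ReC. Qed.

Let J_expand x z (t : R) :
  J (x + t%:C%C *: z) =
  J x + 2 * t * (complex.Re (hdot z x) - complex.Re (phi z)) + t ^+ 2 * nr z ^+ 2.
Proof.
rewrite /J !nr_dot phiD phiZ linearDl/= !linearDr/= !linearZl_LR/=.
rewrite !linearZr_LR/= !conj_real !ReD !ReZ (Re_dotC x z).
ring.
Qed.

Let parallelogram x y :
  nr (x - y) ^+ 2 = 2 * J x + 2 * J y - 4 * J ((2^-1)%:C%C *: (x + y)).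
Proof.
rewrite /J !nr_dot phiZ phiD !linearZl_LR/= !linearZr_LR/= !conj_real.
rewrite !linearDl/= !linearDr/= linearNr linearNl linearNr linearNl.
rewrite !(ReZ, ReD, ReN) (Re_dotC y x).
lra.
Qed.

Let J_lb x : - M ^+ 2 <= J x.
Proof.
have : complex.Re (phi x) <= M * nr x.
  apply: (le_trans (ler_norm _)); apply: (le_trans (Re_le _)).
  have := phi_bnd x; rewrite nrE -rmorphM/= lecE/=.
  by case/andP.
rewrite /J => h.
have := sqr_ge0 (nr x - M); nra.
Qed.

Let m : R := inf (range J).

Let J_has_inf : has_inf (range J).
Proof.
split; first by exists (J 0), 0.
by exists (- M ^+ 2) => _ [x _ <-]; exact: J_lb.
Qed.

Let m_le x : m <= J x.
Proof. by apply: ge_inf; [case: J_has_inf|exists x]. Qed.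

Let D (e : R) : set H := [set x | J x < m + e].

Let D_nonempty e : 0 < e -> D e !=set0.
Proof.
move=> e0; have [_ [x _ <-] xe] := inf_adherent e0 J_has_inf.
by exists x.
Qed.

Let F : set_system H := filter_from [set e : R | 0 < e] D.

Let F_filter : ProperFilter F.
Proof.
apply: filter_from_proper; last by move=> e; exact: D_nonempty.
apply: filter_from_filter; first by exists 1 => /=.
move=> e f e0 f0; exists (Num.min e f); first by rewrite /= lt_min e0 f0.
move=> x; rewrite /D/= => xm; split; apply: lt_le_trans xm _;
  by rewrite lerD2l ge_min lexx ?orbT.
Qed.

Let F_cauchy : cauchy F.
Proof.
have FF := F_filter; apply: cauchy_exP => eps eps0.
have epsE : eps = (complex.Re eps)%:C%C by rewrite RRe_real// gtr0_real.
set r := complex.Re eps in epsE.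
have r0 : 0 < r by rewrite -ltcR -epsE.
have e0 : 0 < r ^+ 2 / 8 by rewrite divr_gt0// exprn_gt0.
have [x Dx] := D_nonempty e0; exists x; exists (r ^+ 2 / 8) => //.
move=> y Dy; rewrite -ball_normE/= nrE epsE ltcR.
rewrite -(@ltr_pXn2r _ 2) ?nnegrE ?(ltW r0)// parallelogram.
have := m_le ((2^-1)%:C%C *: (x + y)); move: Dx Dy; rewrite /D/=; lra.
Qed.

Let Re_rep : exists y, forall z, complex.Re (hdot z y) = complex.Re (phi z).
Proof.
have FF := F_filter.
have /cvg_ex[x0 Fx0] : cvg F by apply: cauchy_cvg; exact: F_cauchy.
exists x0 => z; apply/eqP; rewrite -subr_eq0; apply/negPn/negP => c0.
set c := _ - _ in c0.
pose N := nr z ^+ 2 + 1.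
have N0 : 0 < N by rewrite ltr_wpDl// sqr_ge0.
have nc0 : 0 < `|c| by rewrite normr_gt0.
pose s := (2 * N)^-1.
have s0 : 0 < s by rewrite invr_gt0 mulr_gt0.
pose d := `|c| / 4 / (nr z + 1).
have z1 : 0 < nr z + 1 by rewrite ltr_wpDl.
have d0 : 0 < d by rewrite divr_gt0// divr_gt0.
pose e := s * c ^+ 2 / 4.
have c20 : 0 < c ^+ 2 by rewrite exprn_even_gt0.
have e0 : 0 < e by rewrite divr_gt0// mulr_gt0.
have FD : F (D e) by exists e.
have Fb : F [set x | `|x0 - x| < d%:C%C].
  have dC : 0 < d%:C%C by rewrite ltcR.
  by have := Fx0 _ (nbhsx_ballx x0 _ dC); rewrite -ball_normE.
have [x [Dx]] := filter_ex (filterI FD Fb).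
rewrite /= nrE ltcR => xx0.
pose cx := complex.Re (hdot z x) - complex.Re (phi z).
have cxE : `|c - cx| <= `|c| / 4.
  have -> : c - cx = complex.Re (hdot z (x0 - x)).
    by rewrite linearBr/= ReD ReN /c /cx; ring.
  apply: le_trans (Re_le _) _.
  have /= := hdot_CauchySchwarz z (x0 - x).
  rewrite !nrE -rmorphM/= lecE => /andP[_ /=] /le_trans; apply.
  apply: (@le_trans _ _ ((nr z + 1) * d)).
    by apply: ler_pM => //; [rewrite lerDl|exact: ltW].
  by rewrite /d mulrC divfK// gt_eqF.
have := m_le (x + (- s * c)%:C%C *: z).
rewrite J_expand -/cx => mJ.
have h1 : c ^+ 2 / 2 <= c * cx.
  have h2 : `|c * (c - cx)| <= c ^+ 2 / 4.
    rewrite normrM -[c ^+ 2]real_normK ?num_real// expr2 -mulrA.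
    by rewrite ler_wpM2l.
  have := ler_norm (c * (c - cx)); nra.
have sN : s * nr z ^+ 2 <= 2^-1.
  by rewrite /s mulrC ler_pdivrMr ?mulr_gt0// /N; lra.
have h3 : (- s * c) ^+ 2 * nr z ^+ 2 <= s * c ^+ 2 / 2.
  have -> : (- s * c) ^+ 2 * nr z ^+ 2 = s * c ^+ 2 * (s * nr z ^+ 2) by ring.
  by apply: ler_wpM2l => //; rewrite mulr_ge0// ltW.
have h4 : s * (c ^+ 2 / 2) <= s * (c * cx) by rewrite ler_pM2l.
move: Dx; rewrite /D/= /e.
have h5 : 2 * (- s * c) * cx = - 2 * (s * (c * cx)) by ring.
have sc : 0 < s * c ^+ 2 by rewrite mulr_gt0.
rewrite h5 in mJ; lra.
Qed.

Lemma Riesz_representation : exists y, forall x, phi x = hdot x y.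
Proof.
have [y hy] := Re_rep; exists y => x.
have h1 := hy x; have := hy (- 'i%C *: x).
rewrite phiZ linearZl_LR/=; move: h1.
case: (phi x) (hdot x y) => [a b] [c d] /= -> h; congr (_ +i* _)%C.
by move: h; rewrite !mulN1r !oppr0 !mul0r !sub0r !opprK.
Qed.

End Riesz.

Section BoundedOperators.
Variables (R : realType) (H : hilbertType R).

Definition bounded_op : {pred H -> H} := [pred f : H -> H |
  `[< linear f /\ exists M : R, forall x, `|f x| <= M%:C%C * `|x| >]].

Lemma bounded_opP (f : H -> H) : reflect
  (linear f /\ exists2 M : R, 0 <= M & forall x, `|f x| <= M%:C%C * `|x|)
  (f \in bounded_op).
Proof.
apply: (iffP (asboolP _)) => -[fl].
  move=> [M fM]; split=> //; exists (Num.max 0 M); first by rewrite le_max lexx.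
  move=> x; apply: le_trans (fM x) _; apply: ler_wpM2r => //.
  by rewrite lecR le_max lexx orbT.
by move=> [M _ fM]; split=> //; exists M.
Qed.

Lemma bounded_op_submod_closed : submod_closed bounded_op.
Proof.
split.
  apply/bounded_opP; split; first by move=> a x y; rewrite /= scaler0 addr0.
  by exists 0 => // x; rewrite normr0 mul0r.
move=> a f g /bounded_opP[fl [Mf Mf0 fM]] /bounded_opP[gl [Mg Mg0 gM]].
apply/bounded_opP; split.
  move=> b x y; rewrite !fctE/= fl gl !scalerDr !scalerA [b * a]mulrC addrACA.
  by rewrite -!scalerA.
have aE : `|a| = (complex.Re `|a|)%:C%C by rewrite RRe_real ?normr_real.
exists (complex.Re `|a| * Mf + Mg).
  by rewrite addr_ge0 ?mulr_ge0// -ler0c -aE.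
move=> x; rewrite !fctE/= rmorphD rmorphM/= -aE mulrDl.
apply: le_trans (ler_normD _ _) _; apply: lerD => //.
by rewrite normrZ -mulrA ler_wpM2l.
Qed.

HB.instance Definition _ := GRing.isSubmodClosed.Build R[i] (H -> H) bounded_op
  bounded_op_submod_closed.

Record bop := Bop { bop_fun :> H -> H ; _ : bop_fun \in bounded_op }.

HB.instance Definition _ := [isSub for bop_fun].
HB.instance Definition _ := [Choice of bop by <:].
HB.instance Definition _ := [SubChoice_isSubLmodule of bop by <:].

Implicit Types (S T : bop) (x y : H).

Lemma bop_linear T : linear T.
Proof. by have /bounded_opP[] := valP T. Qed.

HB.instance Definition _ T :=
  GRing.isLinear.Build R[i] H H _ (bop_fun T) (bop_linear T).

Lemma bop_bounded T :
  exists2 M : R, 0 <= M & forall x, `|T x| <= M%:C%C * `|x|.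
Proof. by have /bounded_opP[] := valP T. Qed.

Lemma bopP S T : S =1 T -> S = T.
Proof. by move=> ST; apply/val_inj/funext. Qed.

Lemma bopD S T x : (S + T) x = S x + T x.
Proof. by []. Qed.

Lemma bopZ a T x : (a *: T) x = a *: T x.
Proof. by []. Qed.

Lemma hdot_inj x y : (forall z, hdot z x = hdot z y) -> x = y.
Proof.
move=> xy; apply/eqP; rewrite -subr_eq0 -(dnorm_eq0 hdot) linearBr/=.
by rewrite xy subrr.
Qed.

Lemma adjoint_exists T :
  exists S, forall x y, hdot (T x) y = hdot x (S y).
Proof.
have [M M0 TM] := bop_bounded T.
have /choice[S TS] y : exists z, forall x, hdot (T x) y = hdot x z.
  have yE : `|y| = (complex.Re `|y|)%:C%C by rewrite RRe_real ?normr_real.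
  apply: (@Riesz_representation _ _ _ (M * complex.Re `|y|)).
    by move=> a u v; rewrite linearP linearDl/= linearZl_LR.
  move=> x; rewrite rmorphM/= -yE mulrAC.
  by apply: le_trans (hdot_CauchySchwarz _ _) _; rewrite ler_wpM2r.
have SB : S \in bounded_op.
  apply/bounded_opP; split.
    move=> a u v; apply: hdot_inj => x; rewrite -TS !linearDr/= !linearZr_LR/=.
    by rewrite !TS.
  exists M => // y; have [->|Sy0] := eqVneq (S y) 0.
    by rewrite normr0 mulr_ge0// ler0c.
  rewrite -(@ler_pM2l _ `|S y|) ?normr_gt0// -expr2 -hdot_norm -TS.
  rewrite mulrA [`|S y| * _]mulrC -[hdot _ _]ger0_norm; last first.
    by rewrite TS dnorm_ge0.
  by apply: le_trans (hdot_CauchySchwarz _ _) _; rewrite ler_wpM2r.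
by exists (Bop SB).
Qed.

Definition adj T : bop := sval (cid (adjoint_exists T)).

Lemma adjP T x y : hdot (T x) y = hdot x (adj T y).
Proof. by rewrite /adj; case: cid => S /= ->. Qed.

(* `|T x| lives in R[i], with zero imaginary part. The unit ball is taken closed,
   so that the supremum is over a nonempty set even when H = 0. *)
Definition opnorm T : R := sup [set complex.Re `|T x| | x in [set x | `|x| <= 1]].

Definition re_op T : bop := 2^-1 *: (T + adj T).

Definition im_op T : bop := (2 * 'i%C)^-1 *: (T - adj T).

Lemma cartesian_decomposition T : T = re_op T + 'i%C *: im_op T.
Proof.
have i0 : 'i%C != 0 :> R[i] by rewrite eq_complex/= oner_eq0 andbF.
rewrite /re_op /im_op (scalerA 'i%C (2 * 'i%C)^-1 (T - adj T)).
have -> : 'i%C * (2 * 'i%C)^-1 = 2^-1 :> R[i].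
  by rewrite invfM mulrCA mulfV// mulr1.
rewrite -(scalerDr 2^-1 (T + adj T)) addrACA subrr addr0 -mulr2n.
by rewrite -(scaler_nat 2 T) (scalerA 2^-1 2%:R T) mulVf ?scale1r ?pnatr_eq0.
Qed.

Definition positive_op T : Prop := forall x, 0 <= hdot (T x) x.

Definition accretive_dissipative T : Prop :=
  positive_op (re_op T) /\ positive_op (im_op T).

End BoundedOperators.

Notation "''B' ( H )" := (bop H) (at level 8, format "''B' ( H )") : type_scope.

Section Block.
Variables (R : realType) (H : hilbertType R).
Implicit Types A B C D : 'B(H).

Definition block_fun A B C D (x : hsum H H) : hsum H H :=
  (A x.1 + B x.2, C x.1 + D x.2).

Lemma block_fun_bounded A B C D : block_fun A B C D \in @bounded_op R (hsum H H).
Proof.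
apply/bounded_opP; split.
  move=> a x y; congr (_, _); rewrite /= !linearP scalerDr addrACA//.
have [MA MA0 hA] := bop_bounded A; have [MB MB0 hB] := bop_bounded B.
have [MC MC0 hC] := bop_bounded C; have [MD MD0 hD] := bop_bounded D.
exists ((MA + MB) + (MC + MD)); first by rewrite !addr_ge0.
have bnd (T : 'B(H)) (M : R) (u : H) (x : hsum H H) : 0 <= M ->
    (forall z, `|T z| <= M%:C%C * `|z|) -> `|u| <= `|x| ->
    `|T u| <= M%:C%C * `|x|.
  move=> M0 hT ux; apply: le_trans (hT u) _.
  by rewrite ler_wpM2l// ler0c.
move=> x; apply: le_trans (hsum_normD _) _ => /=.
rewrite !rmorphD/= !mulrDl; apply: lerD;
  apply: le_trans (ler_normD _ _) _; apply: lerD; apply: bnd => //;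
  by [exact: hsum_norm1|exact: hsum_norm2].
Qed.

(* [A B; C D] *)
Definition block_op A B C D : 'B(hsum H H) := Bop (block_fun_bounded A B C D).

End Block.

(* Main.v *)
Require Import Defs.
From mathcomp Require Import all_boot all_order all_algebra.
From mathcomp Require Import complex reals.
From mathcomp Require Import classical_sets normedtype.
From mathcomp Require Import ring lra.
Import Order.TTheory GRing.Theory Num.Theory.
Local Open Scope ring_scope.

(** Write [T = A + iB] with [A, B >= 0], and let [a], [b] bound the quadratic
    forms of [A] and [B].  The proof has two independent halves.

    The first is [|T|^2 <= a^2 + b^2] ([positive_cartesian_bound]).  For a unit
    vector [x] put [p = <Ax,x>] and [q = <Bx,x>].  The Cauchy-Schwarz inequality
    for the form of [A] gives [|Ax|^2 <= a p], and likewise [|Bx|^2 <= b q].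
    The cross term of [|Ax + iBx|^2] is twice the imaginary part of [<Ax,Bx>].
    As [p] and [q] are real, this part is unchanged when [Ax] and [Bx] are
    replaced by their components [Ax - px] and [Bx - qx] orthogonal to [x],
    whose squared lengths are at most [p (a - p)] and [q (b - q)].  Hence
    [|Tx|^2 <= a p + b q + 2 sqrt (p q (a - p) (b - q))], and since [p <= a] and
    [q <= b], the root is at most [sqrt (a (a - p) b (b - q))], so that the
    inequality of arithmetic and geometric means bounds the last term by
    [a (a - p) + b (b - q)].

    The second half bounds the form of a positive block operator by the sum of
    the norms of its diagonal blocks ([block_form_le]): the Cauchy-Schwarz
    inequality for that form controls the off-diagonal terms by the diagonal
    ones.

    Everything takes place in the underlying real inner product space, through
    the real part [rdot] of the inner product. *)

(** * Real quadratic inequalities *)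

Lemma discr_le0 (R : realFieldType) (a b c : R) :
  (forall t, 0 <= a * t ^+ 2 + 2 * b * t + c) -> b ^+ 2 <= a * c.
Proof.
move=> h; have c0 : 0 <= c by have := h 0; rewrite expr0n /= !mulr0 !add0r.
have [a0|a0|a0] := ltgtP a 0.
- (* A negative leading coefficient is excluded by a large value of [t]. *)
  pose t := (2 * `|b| + c + 1) / - a + 1.
  have b0 := normr_ge0 b; have bb := ler_norm b.
  have e : a * t = a - (2 * `|b| + c + 1) by rewrite /t; field; lra.
  have t1 : 1 <= t.
    by rewrite /t lerDr divr_ge0//; lra.
  have := h t; rewrite (_ : a * t ^+ 2 = (a * t) * t); last by ring.
  rewrite e; nra.
- have := h (- b / a).
  have -> : a * (- b / a) ^+ 2 + 2 * b * (- b / a) + c = c - b ^+ 2 / a.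
    by field; lra.
  by rewrite subr_ge0 ler_pdivrMr// mulrC.
- have [->|b0] := eqVneq b 0; first by rewrite expr0n /= a0 mul0r.
  have := h (- (c + 1) / (2 * b)); rewrite a0 mul0r add0r.
  rewrite (_ : 2 * b * _ = - (c + 1)); last by field.
  by lra.
Qed.

Lemma amgm2 {R : realFieldType} {r s t : R} :
  0 <= s -> 0 <= t -> r ^+ 2 <= s * t -> 2 * r <= s + t.
Proof.
move=> s0 t0 h; apply: le_trans (ler_norm _) _.
rewrite -(@ler_pXn2r _ 2) ?nnegrE ?addr_ge0// real_normK ?num_real//.
have := sqr_ge0 (s - t); nra.
Qed.

(** * The underlying real inner product space *)

Lemma Re_conj (R : rcfType) (z : R[i]) :
  complex.Re (Num.conj z) = complex.Re z.
Proof. by case: z. Qed.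

Lemma Im_conj (R : rcfType) (z : R[i]) :
  complex.Im (Num.conj z) = - complex.Im z.
Proof. by case: z. Qed.

Section RealDot.
Context {R : realType} {H : hilbertType R}.
Implicit Types (x y z : H) (t : R).

Definition rdot x y : R := complex.Re (hdot x y).

Lemma rdotC x y : rdot x y = rdot y x.
Proof. by rewrite /rdot hermC mul1r Re_conj. Qed.

Lemma rdotDl x y z : rdot (x + y) z = rdot x z + rdot y z.
Proof. by rewrite /rdot linearDl/=; case: (hdot x z) (hdot y z) => ? ? []. Qed.

Lemma rdotDr x y z : rdot x (y + z) = rdot x y + rdot x z.
Proof. by rewrite rdotC rdotDl !(rdotC x). Qed.

Lemma rdot0r x : rdot x 0 = 0.
Proof. by rewrite /rdot linear0r. Qed.

Lemma rdotZl t x y : rdot (t%:C%C *: x) y = t * rdot x y.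
Proof.
by rewrite /rdot linearZl_LR/=; case: (hdot x y) => ? ? /=; rewrite mul0r subr0.
Qed.

Lemma rdotZr t x y : rdot x (t%:C%C *: y) = t * rdot x y.
Proof. by rewrite rdotC rdotZl rdotC. Qed.

Lemma rdot_iE x y : rdot x ('i%C *: y) = complex.Im (hdot x y).
Proof. by rewrite /rdot linearZr_LR/=; case: (hdot x y) => ? ? /=; ring. Qed.

Lemma rdot_ii x y : rdot ('i%C *: x) ('i%C *: y) = rdot x y.
Proof.
rewrite rdot_iE /rdot linearZl_LR/=; case: (hdot x y) => ? ? /=; ring.
Qed.

Lemma normr_Re x : `|x| = (complex.Re `|x|)%:C%C.
Proof. by rewrite RRe_real// normr_real. Qed.

Lemma Re_normr_ge0 x : 0 <= complex.Re `|x|.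
Proof. by rewrite -ler0c -normr_Re. Qed.

Lemma rdot_norm x : rdot x x = complex.Re `|x| ^+ 2.
Proof. by rewrite /rdot hdot_norm normr_Re -rmorphXn. Qed.

Lemma rdot_ge0 x : 0 <= rdot x x.
Proof. by rewrite rdot_norm sqr_ge0. Qed.

Lemma rdot_CauchySchwarz x y : rdot x y ^+ 2 <= rdot x x * rdot y y.
Proof.
apply: discr_le0 => t; have := rdot_ge0 (t%:C%C *: x + y).
rewrite !rdotDl !rdotDr !rdotZl !rdotZr (rdotC y x).
by congr (_ <= _); ring.
Qed.

(** * Operator norm and positive operators *)

Lemma opnorm_has_sup (T : 'B(H)) :
  has_sup [set complex.Re `|T x| | x in [set x | `|x| <= 1]]%classic.
Proof.
split; first by exists (complex.Re `|T 0|), 0 => //=; rewrite normr0 ler01.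
have [M M0 TM] := bop_bounded T; exists M => _ [x /= x1 <-].
rewrite -lecR -normr_Re; apply: le_trans (TM x) _.
by rewrite ler_piMr// ler0c.
Qed.

Lemma opnorm_bound (T : 'B(H)) x :
  complex.Re `|T x| <= opnorm T * complex.Re `|x|.
Proof.
have [->|x0] := eqVneq x 0; first by rewrite linear0 normr0 /= mulr0.
set r := complex.Re `|x|.
have r0 : 0 < r by rewrite -ltcR -normr_Re normr_gt0.
have nE : `|r^-1%:C%C : R[i]| = r^-1%:C%C.
  by rewrite ger0_norm// ler0c invr_ge0 ltW.
have : complex.Re `|T (r^-1%:C%C *: x)| <= opnorm T.
  apply: (ub_le_sup (opnorm_has_sup T).2); exists (r^-1%:C%C *: x) => //=.
  by rewrite normrZ nE normr_Re -/r -rmorphM/= mulVf ?gt_eqF.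
rewrite linearZ/= normrZ nE (normr_Re (T x)) -rmorphM/= mulrC.
by rewrite ler_pdivrMr.
Qed.

Lemma opnorm_ge0 (T : 'B(H)) : 0 <= opnorm T.
Proof.
apply: (ub_le_sup (opnorm_has_sup T).2); exists 0; first by rewrite /= normr0 ler01.
by rewrite linear0 normr0.
Qed.

Lemma opnorm_form (T : 'B(H)) x : rdot (T x) x <= opnorm T * rdot x x.
Proof.
apply: le_trans (ler_norm _) _.
rewrite -(@ler_pXn2r _ 2) ?nnegrE ?mulr_ge0 ?opnorm_ge0 ?rdot_ge0//.
rewrite real_normK ?num_real//.
apply: le_trans (rdot_CauchySchwarz _ _) _.
rewrite exprMn expr2 [rdot x x ^+ 2]expr2 mulrA ler_wpM2r ?rdot_ge0//.
rewrite -expr2 !rdot_norm -exprMn ler_pXn2r ?nnegrE ?opnorm_bound//.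
  exact: Re_normr_ge0.
by rewrite mulr_ge0 ?opnorm_ge0 ?Re_normr_ge0.
Qed.

(** The component of [A x] orthogonal to [x] for [rdot], scaled by [|x|^2] so as
    to avoid a division. *)
Definition perp (A : 'B(H)) x : H :=
  (rdot x x)%:C%C *: A x + (- rdot (A x) x)%:C%C *: x.

Section Positive.
Context {A : 'B(H)}.
Hypothesis A0 : positive_op A.

Lemma positive_rdot_ge0 x : 0 <= rdot (A x) x.
Proof. by have := A0 x; rewrite lecE => /andP[_]. Qed.

Lemma positive_Im0 x : complex.Im (hdot (A x) x) = 0.
Proof. by have := A0 x; rewrite lecE => /andP[/eqP]. Qed.

(** A sesquilinear form with real diagonal values is hermitian: this is the
    polarization of the form at [x + iy]. *)
Lemma positive_rdotC x y : rdot (A x) y = rdot (A y) x.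
Proof.
have := positive_Im0 (x + 'i%C *: y).
rewrite (linearD A) linearDl !linearDr/= (linearZ_LR A)/=.
rewrite !linearZl_LR/= !linearZr_LR/=.
have := positive_Im0 x; have := positive_Im0 y; rewrite /rdot.
case: (hdot (A x) x) (hdot (A x) y) (hdot (A y) x) (hdot (A y) y).
move=> a b [c d] [e f] [g h] /= -> ->; lra.
Qed.

Lemma positive_CauchySchwarz x y :
  rdot (A x) y ^+ 2 <= rdot (A x) x * rdot (A y) y.
Proof.
apply: discr_le0 => t; have := positive_rdot_ge0 (t%:C%C *: x + y).
rewrite linearD linearZ/= !rdotDl !rdotDr !rdotZl !rdotZr (positive_rdotC y x).
by congr (_ <= _); ring.
Qed.

Context {a : R}.
Hypothesis Aa : forall x, rdot (A x) x <= a * rdot x x.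

(** The operator inequality [A^2 <= a A], by the Cauchy-Schwarz inequality for
    the form of [A] at [x] and [A x]. *)
Lemma positive_sqr_le x : rdot (A x) (A x) <= a * rdot (A x) x.
Proof.
have h := positive_CauchySchwarz x (A x).
have n0 := rdot_ge0 (A x); have p0 := positive_rdot_ge0 x; have ha := Aa (A x).
have [n1|n1] := ltP 0 (rdot (A x) (A x)).
  by rewrite -(ler_pM2r n1); nra.
have -> : rdot (A x) (A x) = 0 by lra.
have [x0|x0] := ltP 0 (rdot x x).
  by apply: mulr_ge0 => //; have := Aa x; nra.
suff -> : rdot (A x) x = 0 by rewrite mulr0.
by have := rdot_CauchySchwarz (A x) x; nra.
Qed.

Lemma perp_sqr_le x : rdot (perp A x) (perp A x) <=
  rdot x x * (rdot (A x) x * (a * rdot x x - rdot (A x) x)).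
Proof.
rewrite /perp !rdotDl !rdotDr !rdotZl !rdotZr (rdotC x (A x)).
have h := ler_wpM2l (sqr_ge0 (rdot x x)) (positive_sqr_le x).
by move: h; lra.
Qed.

End Positive.

(** The terms of the expansion other than [<Ax,iBx>] are imaginary parts of the
    real numbers [<Ax,x>], [<x,x>] and [<x,Bx>]. *)
Lemma perp_cross {A B : 'B(H)} x :
  positive_op A -> positive_op B ->
  rdot (perp A x) ('i%C *: perp B x) = rdot x x ^+ 2 * rdot (A x) ('i%C *: B x).
Proof.
move=> A0 B0; rewrite /perp scalerDr !scalerA ![_ * (_)%:C%C]mulrC -!scalerA.
rewrite !rdotDl !rdotDr !rdotZl !rdotZr.
have -> : rdot (A x) ('i%C *: x) = 0 by rewrite rdot_iE positive_Im0.
have -> : rdot x ('i%C *: x) = 0.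
  by rewrite rdot_iE hdot_norm normr_Re -rmorphXn.
have -> : rdot x ('i%C *: B x) = 0.
  by rewrite rdot_iE hermC mul1r Im_conj (positive_Im0 B0) oppr0.
by ring.
Qed.

Lemma positive_cartesian_bound {A B : 'B(H)} {a b : R} x :
  positive_op A -> positive_op B ->
  (forall y, rdot (A y) y <= a * rdot y y) ->
  (forall y, rdot (B y) y <= b * rdot y y) ->
  rdot (A x + 'i%C *: B x) (A x + 'i%C *: B x)
    <= (a ^+ 2 + b ^+ 2) * rdot x x.
Proof.
move=> A0 B0 Aa Bb.
have cs := rdot_CauchySchwarz (perp A x) ('i%C *: perp B x).
rewrite rdot_ii (perp_cross x A0 B0) in cs.
have wA := perp_sqr_le A0 Aa x; have wB := perp_sqr_le B0 Bb x.
have sA := positive_sqr_le A0 Aa x; have sB := positive_sqr_le B0 Bb x.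
have pa := Aa x; have qb := Bb x.
have p0 := positive_rdot_ge0 A0 x; have q0 := positive_rdot_ge0 B0 x.
have w0 := rdot_ge0 (perp A x); have z0 := rdot_ge0 (perp B x).
rewrite rdotDl !rdotDr rdot_ii (rdotC ('i%C *: B x) (A x)).
have [->|x0] := eqVneq x 0.
  by rewrite (linear0 A) (linear0 B) scaler0 !rdot0r mulr0 !addr0.
have n0 : 0 < rdot x x.
  by rewrite rdot_norm exprn_gt0// -ltcR -normr_Re normr_gt0.
move: (rdot x x) (rdot (A x) x) (rdot (B x) x) (rdot (A x) (A x))
  (rdot (B x) (B x)) (rdot (A x) ('i%C *: B x)) n0 p0 q0 pa qb sA sB wA wB cs.
move=> n p q s t r n0 p0 q0 pa qb sA sB wA wB cs.
have a0 : 0 <= a by rewrite -(pmulr_lge0 _ n0); lra.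
have b0 : 0 <= b by rewrite -(pmulr_lge0 _ n0); lra.
have u0 : 0 <= a * n - p by lra.
have v0 : 0 <= b * n - q by lra.
have rr : r ^+ 2 <= (a * (a * n - p)) * (b * (b * n - q)).
  have n4 : 0 < n ^+ 4 by rewrite exprn_gt0.
  rewrite -(ler_pM2l n4).
  have e : n ^+ 4 * r ^+ 2 = (n ^+ 2 * r) ^+ 2 by ring.
  rewrite e; apply: le_trans cs _.
  apply: le_trans (ler_pM w0 z0 wA wB) _.
  have -> : n * (p * (a * n - p)) * (n * (q * (b * n - q))) =
    n ^+ 2 * ((a * n - p) * (b * n - q)) * (p * q) by ring.
  have -> : n ^+ 4 * (a * (a * n - p) * (b * (b * n - q))) =
    n ^+ 2 * ((a * n - p) * (b * n - q)) * ((a * n) * (b * n)) by ring.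
  apply: ler_wpM2l; last exact: ler_pM.
  by apply: mulr_ge0; [exact: sqr_ge0|exact: mulr_ge0].
have := amgm2 (mulr_ge0 a0 u0) (mulr_ge0 b0 v0) rr.
by lra.
Qed.

End RealDot.

(** * Positive block operators *)

Lemma block_form_le {R : realType} {H : hilbertType R} (A B C D : 'B(H)) :
  positive_op (block_op A B C D) -> forall x : hsum H H,
  rdot (block_op A B C D x) x <= (opnorm A + opnorm D) * rdot x x.
Proof.
move=> Q0 x; set Q := block_op A B C D in Q0 *.
have hsumE (y z : hsum H H) : rdot y z = rdot y.1 z.1 + rdot y.2 z.2.
  by rewrite /rdot; change (hdot y z) with (hdot y.1 z.1 + hdot y.2 z.2);
    case: (hdot y.1 z.1) (hdot y.2 z.2) => ? ? [].
pose u : hsum H H := (x.1, 0); pose v : hsum H H := (0, x.2).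
have xE : x = u + v.
  by rewrite /u /v; case: (x) => x1 x2; congr (_, _); rewrite /= ?addr0 ?add0r.
have uu : rdot (Q u) u = rdot (A x.1) x.1.
  by rewrite hsumE /= rdot0r addr0 linear0 addr0.
have vv : rdot (Q v) v = rdot (D x.2) x.2.
  by rewrite hsumE /= rdot0r add0r linear0 add0r.
have cs := positive_CauchySchwarz Q0 u v.
rewrite uu vv in cs.
have -> : rdot (Q x) x =
    rdot (A x.1) x.1 + rdot (D x.2) x.2 + 2 * rdot (Q u) v.
  rewrite [in LHS]xE linearD rdotDl !rdotDr uu vv (positive_rdotC Q0 v u).
  by ring.
have p0 := positive_rdot_ge0 Q0 u; have q0 := positive_rdot_ge0 Q0 v.
rewrite uu in p0; rewrite vv in q0.
have pA := opnorm_form A x.1; have qD := opnorm_form D x.2.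
have A0 := opnorm_ge0 A; have D0 := opnorm_ge0 D.
have n0 := rdot_ge0 x.1; have m0 := rdot_ge0 x.2.
rewrite hsumE.
(* The factors are regrouped so that their sum is the pair of products missing
   from the expanded right-hand side. *)
have : rdot (Q u) v ^+ 2 <=
    (opnorm A * rdot x.2 x.2) * (opnorm D * rdot x.1 x.1).
  apply: le_trans cs _; apply: le_trans (ler_pM p0 q0 pA qD) _.
  by rewrite le_eqVlt; apply/orP; left; apply/eqP; ring.
move/(amgm2 (mulr_ge0 A0 m0) (mulr_ge0 D0 n0)); lra.
Qed.

Theorem theorem3p4 (R : realType) (H : hilbertType R) (T : 'B(hsum H H))
    (A11 A12 A22 B11 B12 B22 : 'B(H)) :
  accretive_dissipative T ->
  re_op T = block_op A11 A12 (adj A12) A22 ->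
  im_op T = block_op B11 B12 (adj B12) B22 ->
  opnorm T <= Num.sqrt ((opnorm A11 + opnorm A22) ^+ 2
                        + (opnorm B11 + opnorm B22) ^+ 2).
Proof.
move=> [A0 B0] AE BE; set a := _ + opnorm A22; set b := _ + opnorm B22.
apply: ge_sup; first exact: (opnorm_has_sup T).1.
move=> _ [x /= x1 <-].
rewrite -[X in X <= _](ger0_norm (Re_normr_ge0 _)) -sqrtr_sqr -rdot_norm.
have -> : T x = re_op T x + 'i%C *: im_op T x.
  by rewrite [in LHS](cartesian_decomposition T).
rewrite ler_wsqrtr//.
have := @positive_cartesian_bound _ _ _ _ a b x A0 B0.
have Aa y : rdot (re_op T y) y <= a * rdot y y.
  by rewrite AE; apply: block_form_le; rewrite -AE.
have Bb y : rdot (im_op T y) y <= b * rdot y y.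
  by rewrite BE; apply: block_form_le; rewrite -BE.
move=> /(_ Aa Bb) /le_trans; apply.
rewrite ler_piMr ?addr_ge0 ?sqr_ge0// rdot_norm expr_le1 ?Re_normr_ge0//.
by rewrite -lecR -normr_Re.
Qed.
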